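(* Let $\mathcal{H}$ be a real Hilbert space, $C\subseteq\mathcal{H}$ a nonempty closed convex set, and $F:\mathcal{H}\to\mathcal{H}$ a mapping such that: (i) the solution set $SOL(C,F)$ of the variational inequality is nonempty; (ii) $F$ is monotone on $\mathcal{H}$, i.e. $\langle F(x)-F(y),x-y\rangle\ge 0$ for all $x,y\in\mathcal{H}$; (iii) $F$ is Lipschitz continuous on $\mathcal{H}$ with constant $L>0$, i.e. $\|F(x)-F(y)\|\le L\|x-y\|$ for all $x,y\in\mathcal{H}$. Let $\sigma>0$, $\rho\in(0,1)$, $\mu\in(0,1)$, $\gamma\in(0,2)$ and $x^0\in\mathcal{H}$, and let $\{x^k\}_{k=0}^\infty$ be generated by the modified subgradient extragradient method, where it is assumed that the method does not stop, i.e. $x^k\neq y^k$ for all $k$. Then $\{x^k\}_{k=0}^\infty$ converges weakly to a solution of the variational inequality, i.e. to some point of $SOL(C,F)$.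
   Context: Variational inequality: find $x^*\in C$ such that $\langle F(x^* ),x-x^*\rangle\ge 0$ for all $x\in C$; its solution set is denoted $SOL(C,F)$. For a nonempty closed convex set $D\subseteq\mathcal{H}$, $P_D$ denotes the metric (nearest point) projection onto $D$. Modified subgradient extragradient method (parameters $\sigma>0$, $\rho\in(0,1)$, $\mu\in(0,1)$, $\gamma\in(0,2)$, arbitrary starting point $x^0\in\mathcal{H}$). Given $x^k$: Step 1. Set $\alpha_k=\sigma\rho^{m_k}$ and $y^k=P_C(x^k-\alpha_kF(x^k))$, where $m_k$ is the smallest nonnegative integer such that $\alpha_k\|F(x^k)-F(y^k)\|\le\mu\|x^k-y^k\|$ (that is, the smallest integer $m\ge 0$ such that, with $\alpha=\sigma\rho^m$ and $y=P_C(x^k-\alpha F(x^k))$, one has $\alpha\|F(x^k)-F(y)\|\le\mu\|x^k-y\|$; here $\rho^{m}$ is a power of the fixed number $\rho$). If $x^k=y^k$, stop; otherwise go to Step 2. Step 2. Let $T_k=\{w\in\mathcal{H}:\langle (x^k-\alpha_kF(x^k))-y^k,\,w-y^k\rangle\le 0\}$, $d(x^k,y^k)=(x^k-y^k)-\alpha_k(F(x^k)-F(y^k))$, and $\rho_k=\dfrac{\langle x^k-y^k,d(x^k,y^k)\rangle}{\|d(x^k,y^k)\|^2}$ (the sequence $\rho_k$ is distinct from the parameter $\rho$). Set $x^{k+1}=P_{T_k}(x^k-\gamma\rho_k\alpha_kF(y^k))$, and return to Step 1 with $k+1$ in place of $k$. *)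

(* Defs.v *)
From HB Require Import structures.
From mathcomp Require Import all_boot all_order all_algebra.
From mathcomp Require Import all_classical all_reals all_analysis.
Set Implicit Arguments.
Unset Strict Implicit.
Unset Printing Implicit Defensive.
Import Order.TTheory GRing.Theory Num.Theory.
Import numFieldNormedType.Exports.
Local Open Scope classical_set_scope.
Local Open Scope ring_scope.

Section Hilbert.
Context {R : realType} {H : completeNormedModType R}.

(* [{dot H for idfun}] is the type of symmetric positive definite bilinear
   forms on [H]. A real Hilbert space is a complete normed space [H] together
   with an [ip] of that type satisfying [induces_norm ip]. *)
Definition induces_norm (ip : {dot H for idfun}) : Prop :=
  forall x : H, `|x| = Num.sqrt (ip x x).

Definition weak_cvg (u : nat -> H) (l : H) : Prop :=
  forall f : {linear H -> R^o}, continuous f -> f (u n) @[n --> \oo] --> f l.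

Definition nearest_point (D : set H) (x : H) : set H :=
  [set p | D p /\ forall q, D q -> `|x - p| <= `|x - q|].

(* The nearest point exists and is unique for nonempty closed convex [D]; the
   default value [0] is only returned when there is none. *)
Definition metric_proj (D : set H) (x : H) : H := xget 0 (nearest_point D x).

End Hilbert.

Section VariationalInequality.
Context {R : realType} {H : completeNormedModType R}.
Variables (ip : {dot H for idfun}) (C : set H) (F : H -> H).

Definition SOL : set H :=
  [set xs | C xs /\ forall x, C x -> 0 <= ip (F xs) (x - xs)].

Definition monotone_map : Prop := forall x y, 0 <= ip (F x - F y) (x - y).

Definition trial_point (alpha : R) (x : H) : H :=
  metric_proj C (x - alpha *: F x).

Definition linesearch_test (mu alpha : R) (x : H) : Prop :=
  alpha * `|F x - F (trial_point alpha x)| <= mu * `|x - trial_point alpha x|.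

Definition halfspace (alpha : R) (x y : H) : set H :=
  [set w | ip (x - alpha *: F x - y) (w - y) <= 0].

Definition direction (alpha : R) (x y : H) : H :=
  (x - y) - alpha *: (F x - F y).

Definition dir_step (alpha : R) (x y : H) : R :=
  ip (x - y) (direction alpha x y) / `|direction alpha x y| ^+ 2.

Variables (sigma rho mu gamma : R) (x0 : H).

(* [m k] is the line search exponent of iteration [k]. The stopping test is not
   included: for infinite runs, [x k != y k] is a separate hypothesis. *)
Record msegm_run (x y : nat -> H) (m : nat -> nat) : Prop := MsegmRun {
  run_init : x 0%N = x0 ;
  run_linesearch : forall k, linesearch_test mu (sigma * rho ^+ m k) (x k) ;
  run_linesearch_min : forall k j, (j < m k)%N ->
    ~ linesearch_test mu (sigma * rho ^+ j) (x k) ;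
  run_y : forall k, y k = trial_point (sigma * rho ^+ m k) (x k) ;
  run_x : forall k, let alpha := sigma * rho ^+ m k in
    x k.+1 = metric_proj (halfspace alpha (x k) (y k))
      (x k - (gamma * dir_step alpha (x k) (y k) * alpha) *: F (y k))
}.

End VariationalInequality.

(* Main.v *)
Require Import Defs.
From HB Require Import structures.
From mathcomp Require Import all_boot all_order all_algebra.
From mathcomp Require Import all_classical all_reals all_analysis.
From mathcomp Require Import ring lra.
Set Implicit Arguments.
Unset Strict Implicit.
Unset Printing Implicit Defensive.
Import Order.TTheory GRing.Theory Num.Theory.
Import numFieldNormedType.Exports.
Local Open Scope classical_set_scope.
Local Open Scope ring_scope.

(* For a solution [u], the inequalities for the projection onto the halfspace
   [T_k], for [u \in C `<=` T_k] and for the monotonicity of [F] combine, after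
   completing the square [`|x_k - x_{k+1} - gamma rho_k d|^2], into
   [`|x_{k+1} - u|^2 <= `|x_k - u|^2 - c `|x_k - y_k|^2] with [c > 0]. So the
   sequence is Fejer monotone with respect to the solutions and
   [x_k - y_k --> 0]. The Lipschitz bound keeps [alpha_k] away from [0], so the
   inequality characterizing [y_k] passes to the limit and, by Minty's lemma,
   every weak limit point is a solution; Opial's argument gives convergence.
   Weak limit points are taken along ultrafilters finer than [\oo]: bounded
   scalar sequences converge along them, and Riesz representation turns the
   limit functional into a vector, so no subsequence has to be extracted. *)

(** * Bilinearity, the induced norm and Cauchy-Schwarz *)

Section InnerProduct.
Context {R : realType} {H : completeNormedModType R}.
Variable ip : {dot H for idfun}.
Implicit Types u v w : H.

Lemma ipC u v : ip u v = ip v u.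
Proof. by rewrite hermC /= expr0 mul1r. Qed.

Lemma ipDl u v w : ip (u + v) w = ip u w + ip v w.
Proof. exact: linearDl. Qed.

Lemma ipDr u v w : ip w (u + v) = ip w u + ip w v.
Proof. exact: linearDr. Qed.

Lemma ipNl u w : ip (- u) w = - ip u w.
Proof. exact: linearNl. Qed.

Lemma ipNr u w : ip w (- u) = - ip w u.
Proof. exact: linearNr. Qed.

Lemma ipZl a u w : ip (a *: u) w = a * ip u w.
Proof. exact: linearZl_LR. Qed.

Lemma ipZr a u w : ip w (a *: u) = a * ip w u.
Proof. exact: linearZr_LR. Qed.

Definition ipE := (ipDl, ipDr, ipNl, ipNr, ipZl, ipZr).

Hypothesis ipH : induces_norm ip.

Lemma normE u : `|u| ^+ 2 = ip u u.
Proof.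
rewrite ipH sqr_sqrtr //; have [->|u0] := eqVneq u 0; first by rewrite linear0r.
exact/ltW/neq0_dnorm_gt0.
Qed.

Lemma ip_le_norm u v : `|ip u v| <= `|u| * `|v|.
Proof.
have [->|u0] := eqVneq u 0; first by rewrite linear0l !normr0 mul0r.
rewrite -(@ler_pXn2r _ 2) ?nnegrE ?mulr_ge0// exprMn !normE.
rewrite real_normK ?num_real//.
have uu : 0 < ip u u by exact: neq0_dnorm_gt0.
(* The component of [v] orthogonal to [u] has squared norm [c - b ^+ 2 / a]; its nonnegativity is
   Cauchy-Schwarz. *)
have := sqr_ge0 `|v - (ip u v / ip u u) *: u|.
rewrite normE !ipE (ipC v u).
set a := ip u u in uu *; set b := ip u v; set c := ip v v => h.
have -> : b ^+ 2 = a * (c - (c - b ^+ 2 / a)) by field; exact: lt0r_neq0.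
rewrite ler_pM2l// lerBlDr lerDl.
rewrite [leRHS](_ : _ = c - b ^+ 2 / a)// in h.
by field; exact: lt0r_neq0.
Qed.

End InnerProduct.

(** * Nearest points of closed convex sets *)

Section Projection.
Context {R : realType} {H : completeNormedModType R}.
Variable ip : {dot H for idfun}.
Hypothesis ipH : induces_norm ip.
Implicit Types (D : set H) (u v w x p q : H).

Lemma convex_segment D p q (t : R) : convex_set D -> D p -> D q ->
  0 <= t <= 1 -> D (p + t *: (q - p)).
Proof.
move=> cD Dp Dq /andP[t0 t1].
have := cD q p (Itv01 t0 t1) (mem_set Dq) (mem_set Dp).
rewrite inE; congr (D _).
rewrite [LHS]/(t *: q + (1 - t) *: p) scalerBl scale1r scalerBr.
by rewrite addrCA.
Qed.

Lemma normD2 u v : `|u + v| ^+ 2 = `|u| ^+ 2 + 2 * ip u v + `|v| ^+ 2.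
Proof. by rewrite !(normE ipH) !ipE (ipC ip v u); ring. Qed.

Lemma normB2 u v : `|u - v| ^+ 2 = `|u| ^+ 2 - 2 * ip u v + `|v| ^+ 2.
Proof. by rewrite normD2 normrN ipNr mulrN. Qed.

(** Replaces a limit [t --> 0] in the first-order arguments, where a small step [t] along a segment
    leaves an error [t * b]. *)
Lemma ler_arbitrarily_small (a b : R) :
  (forall t, 0 < t < 1 -> a <= t * b) -> a <= 0.
Proof.
move=> h; rewrite leNgt; apply/negP => a0.
have b0 : 0 < b.
  by have : a <= 2^-1 * b by [apply: h; lra]; lra.
(* With [a], [b] positive this [t] is below 1 and [t * b < a / 2]. *)
have := h (a / (2 * (a + b))).
have ab : 0 < 2 * (a + b) by lra.
rewrite divr_gt0//= ltr_pdivrMr// => /(_ ltac:(lra)).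
by rewrite mulrAC ler_pdivlMr//; nra.
Qed.

(** Parallelogram law: the midpoint of [q] and [q'] lies in [D], so its squared distance to [x] is
    at least [d]. Hence minimizing sequences are Cauchy. *)
Lemma near_minimizers_close D x (d e e' : R) q q' : convex_set D ->
  (forall p, D p -> d <= `|x - p| ^+ 2) -> D q -> D q' ->
  `|x - q| ^+ 2 <= d + e -> `|x - q'| ^+ 2 <= d + e' ->
  `|q - q'| ^+ 2 <= 2 * (e + e').
Proof.
move=> cD dD Dq Dq' hq hq'.
have /dD : D (q + 2^-1 *: (q' - q)) by apply: convex_segment => //; lra.
have -> : x - (q + 2^-1 *: (q' - q)) = (x - q) - 2^-1 *: ((x - q) - (x - q')).
  rewrite opprD addrA; congr (_ - _ *: _).
  by rewrite opprB [RHS]addrC subrKA.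
have -> : q - q' = (x - q') - (x - q).
  by rewrite opprB [RHS]addrC subrKA.
rewrite normB2 normrZ exprMn ipZr normrV ?unitfE// normr_nat.
rewrite (normB2 (x - q)) (normB2 (x - q')) (ipC ip (x - q')).
rewrite ipDr ipNr -(normE ipH) (expr2 2^-1).
set A := `|x - q| ^+ 2 in hq *; set B := `|x - q'| ^+ 2 in hq' *.
set c := ip _ _; lra.
Qed.

Lemma nearest_point_exists D x :
  D !=set0 -> closed D -> convex_set D -> nearest_point D x !=set0.
Proof.
move=> [q0 Dq0] clD cD.
set E := [set `|x - q| ^+ 2 | q in D].
have E0 : has_inf E.
  split; first by exists (`|x - q0| ^+ 2), q0.
  by exists 0 => _ [q _ <-]; exact: sqr_ge0.
have dD p : D p -> inf E <= `|x - p| ^+ 2.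
  by move=> Dp; apply: ge_inf; [case: E0|exists p].
have /choice[q Dq] : forall n,
    exists q, D q /\ `|x - q| ^+ 2 <= inf E + n.+1%:R^-1.
  move=> n; have n0 : (0 : R) < n.+1%:R^-1 by rewrite invr_gt0.
  have [_ [p Dp <-] /ltW ?] := inf_adherent n0 E0.
  by exists p.
have cvq : cvg (q @ \oo).
  apply/cauchy_cvgP/cauchy_exP => e e0.
  (* Two errors below [e ^+ 2 / 4] make the bound [2 * (e + e')] of [near_minimizers_close] smaller
     than [e ^+ 2]. *)
  have e20 : 0 < e ^+ 2 / 4 by rewrite divr_gt0// exprn_gt0.
  have [N _ hN] := near_infty_natSinv_lt (PosNum e20).
  exists (q N); exists N => //= n /= Nn.
  rewrite -ball_normE /= -(@ltr_pXn2r _ 2) ?nnegrE ?normr_ge0 ?ltW//.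
  have [DN qN] := Dq N; have [Dn qn] := Dq n.
  apply: le_lt_trans (near_minimizers_close cD dD DN Dn qN qn) _.
  have ltN : N.+1%:R^-1 < e ^+ 2 / 4 := hN N (leqnn N).
  have ltn : n.+1%:R^-1 < e ^+ 2 / 4 := hN n Nn.
  by move: (N.+1%:R^-1) (n.+1%:R^-1) ltN ltn => a b; lra.
exists (lim (q @ \oo)); split.
  by apply: (closed_cvg _ clD) cvq; near=> n; exact: (Dq n).1.
suff h : `|x - lim (q @ \oo)| ^+ 2 <= inf E.
  move=> p Dp; rewrite -(@ler_pXn2r _ 2) ?nnegrE ?normr_ge0//.
  exact: le_trans h (dD _ Dp).
have cvd : `|x - q n| ^+ 2 @[n --> \oo] --> `|x - lim (q @ \oo)| ^+ 2.
  rewrite expr2; under eq_fun do rewrite expr2.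
  by apply: cvgM; apply: cvg_norm; apply: cvgB => //; exact: cvg_cst.
have cve : inf E + n.+1%:R^-1 @[n --> \oo] --> inf E.
  rewrite -[X in _ --> X]addr0; apply: cvgD; first exact: cvg_cst.
  exact: cvg_harmonic.
by apply: ler_cvg_to cvd cve _; near=> n; exact: (Dq n).2.
Unshelve. all: by end_near. Qed.

(** Moving from [p] towards [q] by a fraction [t] cannot decrease the distance to [x]; expand the
    square, divide by [t] and let [t] tend to 0. *)
Lemma nearest_point_ip_le0 D x p q :
  convex_set D -> nearest_point D x p -> D q -> ip (x - p) (q - p) <= 0.
Proof.
move=> cD [Dp hp] Dq.
suff : 2 * ip (x - p) (q - p) <= 0 by lra.
apply: (@ler_arbitrarily_small _ (`|q - p| ^+ 2)) => t /andP[t0 t1].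
have /hp : D (p + t *: (q - p)) by apply: convex_segment => //; lra.
rewrite -(@ler_pXn2r _ 2) ?nnegrE ?normr_ge0// opprD addrA.
rewrite [X in _ <= X]normB2 ipZr normrZ exprMn real_normK ?num_real// => h.
by rewrite -(ler_pM2l t0); lra.
Qed.

Lemma metric_projP D x : D !=set0 -> closed D -> convex_set D ->
  nearest_point D x (metric_proj D x).
Proof. by move=> D0 clD cD; apply: xgetPex; exact: nearest_point_exists. Qed.

End Projection.

(** * Riesz representation and weak limits along ultrafilters *)

Section WeakLimits.
Context {R : realType} {H : completeNormedModType R}.
Variable ip : {dot H for idfun}.
Hypothesis ipH : induces_norm ip.

(* The representing vector is a multiple of the shortest vector [n] of the
   hyperplane [f = 1]: minimality makes [n] orthogonal to the kernel of [f]. *)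
Lemma riesz_representation (f : {linear H -> R^o}) :
  continuous f -> exists p, forall h, f h = ip p h.
Proof.
have [f0 _|/existsNP[h0 fh0] cf] := pselect (forall h, f h = 0).
  by exists 0 => h; rewrite f0 linear0l.
pose D : set H := [set h | f h = 1].
have D0 : D !=set0.
  exists ((f h0)^-1 *: h0); rewrite /D /= linearZ /=.
  by apply: mulVf; apply/eqP.
have clD : closed D.
  have -> : D = f @^-1` [set 1] by [].
  by apply: closed_comp => [h _|]; [exact: cf|exact: closed_eq].
have cD : convex_set D.
  move=> u v l; rewrite !inE /D /= => fu fv.
  change (f (l%:num *: u + (1 - l%:num) *: v) = 1).
  by rewrite linearP linearZ fu fv /= [_ *: _]mulr1 [_ *: _]mulr1 addrC subrK.
have [n minn] := nearest_point_exists ipH 0 D0 clD cD.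
have fn : f n = 1 by case: minn.
have orth h : f h = 0 -> ip n h = 0.
  (* The projected point is the origin. Testing with both [n + h] and [n - h] turns the one-sided
     inequality into an equality. *)
  move=> fh; have side q : D q -> - ip n (q - n) <= 0.
    by move=> /(nearest_point_ip_le0 ipH cD minn); rewrite sub0r ipNl.
  have /side : D (n + h) by rewrite /D /= linearD fn fh addr0.
  have /side : D (n - h) by rewrite /D /= linearB fn fh subr0.
  rewrite addrAC subrr sub0r addrAC subrr add0r ipNr => ? ?; apply/eqP.
  by rewrite eq_le; apply/andP; split; lra.
have nn : ip n n != 0.
  apply/lt0r_neq0/neq0_dnorm_gt0/eqP => n0.
  by move: fn; rewrite n0 linear0 => /eqP; rewrite eq_sym oner_eq0.
exists ((ip n n)^-1 *: n) => h; rewrite ipZl.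
have : ip n (h - f h *: n) = 0.
  by apply: orth; rewrite linearB linearZ fn /= [_ *: _]mulr1 subrr.
rewrite ipDr ipNr ipZr => /eqP; rewrite subr_eq0 => /eqP ->.
by rewrite mulrCA mulVf ?mulr1.
Qed.

Lemma ultra_bounded_cvg (U : set_system nat) (a : nat -> R) (M : R) :
  UltraFilter U -> (forall n, `|a n| <= M) ->
  exists2 l, `|l| <= M & a n @[n --> U] --> l.
Proof.
move=> UU aM.
have [|l [lM cl]] := @segment_compact R (- M) M (a @ U) _.
  by apply: nearW => n; rewrite /= in_itv /= -ler_norml.
exists l; first by move: lM; rewrite /= in_itv /= ler_norml.
(* An ultrafilter converges to each of its cluster points: otherwise it would contain the preimage
   of the complement of a neighbourhood [V], which the cluster point forbids. *)
move=> V Vl; have [//|nV] := in_ultra_setVsetC (a @^-1` V) UU.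
by have [z []] := cl (~` V) V nV Vl.
Qed.

(** The scalar limits along [U] depend linearly on [h], by uniqueness of limits, and are bounded by
    [M] times the norm of [h]; so they form a continuous functional, represented by [p]. *)
Lemma ultra_bounded_weak_cvg (U : set_system nat) (u : nat -> H) (M : R) :
  UltraFilter U -> (forall n, `|u n| <= M) ->
  exists p, forall h, ip (u n) h @[n --> U] --> ip p h.
Proof.
move=> UU uM.
have /choice[f fP] : forall h, exists l : R,
    `|l| <= M * `|h| /\ ip (u n) h @[n --> U] --> l.
  move=> h.
  have [|l] := @ultra_bounded_cvg U (fun n => ip (u n) h) (M * `|h|) UU.
    move=> n; apply: le_trans (ip_le_norm ipH _ _) _.
    by rewrite ler_wpM2r.
  by exists l.
have f_linear : linear (f : H -> R^o).
  move=> a v w; have [_ cv] := fP v; have [_ cw] := fP w.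
  have [_ cvw] := fP (a *: v + w).
  have cvw' : ip (u n) (a *: v + w) @[n --> U] --> a * f v + f w.
    under eq_fun do rewrite ipDr ipZr.
    by apply: cvgD => //; apply: cvgM => //; exact: cvg_cst.
  exact: (norm_cvg_unique cvw cvw').
pose F : {linear H -> R^o} :=
  HB.pack (f : H -> R^o) (GRing.isLinear.Build _ _ _ _ (f : H -> R^o) f_linear).
have cF : continuous F.
  apply: bounded_linear_continuous; apply/linear_boundedP.
  near=> r => h; apply: le_trans (fP h).1 _.
  by rewrite ler_wpM2r//; near: r; exact: nbhs_pinfty_ge.
have [p pP] := riesz_representation cF.
by exists p => h; rewrite -pP; exact: (fP h).2.
Unshelve. all: by end_near. Qed.

End WeakLimits.

(** * Opial's argument for Fejer monotone sequences *)

Section Opial.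
Context {R : realType} {H : completeNormedModType R}.
Variable ip : {dot H for idfun}.
Hypothesis ipH : induces_norm ip.

(** If the preimage of a neighbourhood [V] were not in [F], then [F] restricted to the complement of
    that preimage would be proper, and an ultrafilter above it would contain two disjoint sets. *)
Lemma cvg_from_ultra (T : Type) (X : topologicalType) (F : set_system T)
    (a : T -> X) (l : X) : Filter F ->
  (forall U, UltraFilter U -> F `<=` U -> a @ U --> l) -> a @ F --> l.
Proof.
move=> FF h V Vl; apply: contrapT => nFV.
pose G := within (~` (a @^-1` V)) F.
have GP : ProperFilter G.
  split; last exact: within_filter.
  rewrite /G /within /= => FG; apply: nFV.
  by apply: filterS FG => t /= nV; apply: contrapT.
have [U [UU GU]] := ultraFilterLemma GP.
have FU : F `<=` U.
  by move=> B FB; apply: GU; rewrite /G /within /=; apply: filterS FB.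
have UV : U (a @^-1` V) by exact: (h U UU FU).
have UnV : U (~` (a @^-1` V)).
  by apply: GU; rewrite /G /within /=; exact: filterE.
have UI : U (a @^-1` V `&` ~` (a @^-1` V)) by exact: filterI.
by move: UI; rewrite setICr; exact: filter_not_empty.
Qed.

Lemma nonincreasing_dist_bounded (x : nat -> H) (u : H) :
  nonincreasing_seq (fun n => `|x n - u| ^+ 2) ->
  forall n, `|x n| <= `|x 0%N - u| + `|u|.
Proof.
move=> dec n; rewrite -[x n](subrK u); apply: le_trans (ler_normD _ _) _.
by rewrite lerD2r -(@ler_pXn2r _ 2) ?nnegrE ?normr_ge0//; exact: dec.
Qed.

(* Opial: along any ultrafilter finer than [\oo] the sequence has a weak limit,
   and two such limits [p], [q] coincide because
   [`|x n - p|^2 - `|x n - q|^2] is affine in [ip (x n) (p - q)] and converges along [\oo]. *)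
Lemma fejer_monotone_weak_cvg (S : set H) (x : nat -> H) :
  S !=set0 ->
  (forall u, S u -> nonincreasing_seq (fun n => `|x n - u| ^+ 2)) ->
  (forall U p, UltraFilter U -> \oo `<=` U ->
    (forall h, ip (x n) h @[n --> U] --> ip p h) -> S p) ->
  exists2 p, S p & weak_cvg x p.
Proof.
move=> [u Su] fejer limS.
have bnd := nonincreasing_dist_bounded (fejer u Su).
have cvgS p : S p -> cvgn (fun n => `|x n - p| ^+ 2).
  move=> Sp; apply: nonincreasing_is_cvgn; first exact: fejer.
  by exists 0 => _ [n _ <-]; exact: sqr_ge0.
have uniq_lim U V p q : UltraFilter U -> UltraFilter V ->
    \oo `<=` U -> \oo `<=` V ->
    (forall h, ip (x n) h @[n --> U] --> ip p h) ->
    (forall h, ip (x n) h @[n --> V] --> ip q h) -> p = q.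
  move=> UU UV oU oV pU qV.
  have Sp := limS U p UU oU pU; have Sq := limS V q UV oV qV.
  pose g n := 2^-1 * (`|p| ^+ 2 - `|q| ^+ 2
                      - (`|x n - p| ^+ 2 - `|x n - q| ^+ 2)).
  have gE : (fun n => ip (x n) (p - q)) = g.
    apply/funext => n; rewrite /g !(normB2 ipH) ipDr ipNr.
    by field.
  have /cvg_ex[m cvm] : cvgn g.
    apply: is_cvgM; first exact: is_cvg_cst.
    apply: is_cvgB; first exact: is_cvg_cst.
    by apply: is_cvgB; exact: cvgS.
  have pm : ip p (p - q) = m.
    apply: norm_cvg_unique (pU (p - q)) _.
    by rewrite gE; apply: cvg_trans cvm => A; exact: oU.
  have qm : ip q (p - q) = m.
    apply: norm_cvg_unique (qV (p - q)) _.
    by rewrite gE; apply: cvg_trans cvm => A; exact: oV.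
  apply/eqP; rewrite -subr_eq0 -normr_eq0 -sqrf_eq0 (normE ipH) ipDl ipNl.
  by rewrite pm qm subrr.
have [U0 [UU0 oU0]] := ultraFilterLemma (F := \oo) _.
have [p pU0] := ultra_bounded_weak_cvg ipH UU0 bnd.
exists p; first exact: limS pU0.
move=> f /(riesz_representation ipH)[v fv].
under eq_fun do rewrite fv ipC; rewrite fv ipC.
(* Each ultrafilter finer than [\oo] gives some weak limit [q], and [uniq_lim] identifies it with
   the [p] chosen along [U0]. *)
apply: cvg_from_ultra => U UU oU.
have [q qU] := ultra_bounded_weak_cvg ipH UU bnd.
by rewrite (uniq_lim _ _ _ _ UU0 UU oU0 oU pU0 qU); exact: qU.
Qed.

End Opial.

(** * One iteration of the method, and its weak limit points *)

Section VariationalInequality.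
Context {R : realType} {H : completeNormedModType R}.
Variable ip : {dot H for idfun}.
Hypothesis ipH : induces_norm ip.
Variables (C : set H) (F : H -> H).
Hypotheses (C0 : C !=set0) (clC : closed C) (cC : convex_set C).
Hypothesis monoF : monotone_map ip F.
Implicit Types (x y z u v w : H) (alpha L mu gamma : R).

Lemma continuous_ipr v : continuous (ip v : H -> R).
Proof.
move=> w; apply/cvgrPdist_lt => e e0; near=> z.
rewrite -ipNr -ipDr; apply: le_lt_trans (ip_le_norm ipH _ _) _.
(* Adding 1 keeps the divisor positive when [v] is 0. *)
have v0 : 0 < `|v| + 1 by rewrite ltr_wpDl.
apply: (@le_lt_trans _ _ ((`|v| + 1) * `|w - z|)).
  by rewrite ler_wpM2r// lerDl.
rewrite mulrC -ltr_pdivlMr//; near: z.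
by apply: cvgr_dist_lt; rewrite ?divr_gt0.
Unshelve. all: by end_near. Qed.

Lemma halfspace_closed alpha x y : closed (halfspace ip F alpha x y).
Proof.
have -> : halfspace ip F alpha x y =
    (ip (x - alpha *: F x - y) \o (fun w => w - y)) @^-1` [set r | r <= 0].
  by [].
apply: closed_comp => [w _|]; last exact: closed_le.
apply: continuous_comp; last exact: continuous_ipr.
by apply: cvgB; [exact: cvg_id|exact: cvg_cst].
Qed.

Lemma halfspace_convex alpha x y : convex_set (halfspace ip F alpha x y).
Proof.
move=> u v l; rewrite !inE /halfspace /= => hu hv.
change (ip (x - alpha *: F x - y)
  (l%:num *: u + (1 - l%:num) *: v - y) <= 0).
set n := x - alpha *: F x - y in hu hv *.
have l0 : 0 <= l%:num by [].
have l1 : l%:num <= 1 by [].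
have : l%:num * ip n (u - y) <= 0 by rewrite mulr_ge0_le0.
have : (1 - l%:num) * ip n (v - y) <= 0 by rewrite mulr_ge0_le0 ?subr_ge0.
rewrite !ipE; lra.
Qed.

Lemma trial_point_in alpha x : C (trial_point C F alpha x).
Proof. by have [] := metric_projP ipH (x - alpha *: F x) C0 clC cC. Qed.

(** This is the inclusion of [C] in [halfspace] at the trial point. *)
Lemma trial_point_ip_le0 alpha x z : C z ->
  ip (x - alpha *: F x - trial_point C F alpha x)
     (z - trial_point C F alpha x) <= 0.
Proof. exact/(nearest_point_ip_le0 ipH cC)/(metric_projP ipH). Qed.

(** Test at [p + t *: (z - p)] and divide by [t]; the Lipschitz bound replaces [F] there by [F p] at
    a cost proportional to [t]. *)
Lemma minty L p : 0 < L -> (forall u v, `|F u - F v| <= L * `|u - v|) ->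
  C p -> (forall z, C z -> 0 <= ip (F z) (z - p)) -> SOL ip C F p.
Proof.
move=> L0 lipF Cp hp; split=> // z Cz.
rewrite -oppr_le0; apply: (@ler_arbitrarily_small _ _ (L * `|z - p| ^+ 2)).
move=> t /andP[t0 t1].
have := hp _ (convex_segment cC Cp Cz (t := t) _).
rewrite addrAC subrr add0r ipZr pmulr_rge0// => /(_ ltac:(lra)).
set q := p + _ => Fq.
have := ip_le_norm ipH (F q - F p) (z - p).
move=> /(le_trans (ler_norm _)) /le_trans; rewrite ipDl ipNl.
move=> /(_ (L * `|q - p| * `|z - p|)); rewrite ler_wpM2r// => /(_ isT).
rewrite /q addrAC subrr add0r normrZ gtr0_norm// expr2; lra.
Qed.

Lemma SOL_dual u z : SOL ip C F u -> C z -> 0 <= ip (F z) (z - u).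
Proof.
move=> [Cu hu] Cz; have := monoF z u; have := hu z Cz.
by rewrite ipDl ipNl; lra.
Qed.

(** Algebraic core of an iteration: [b] stands for [x - y], [g] for [F y], [v] for the normal of the
    halfspace, [d] for the direction and [r] for its step. The three inequalities say that [x'] is
    the projection, that [x'] lies in the halfspace, and that [u] solves the dual inequality at
    [y]. *)
Lemma projection_step (x x' u b g v d : H) (r s alpha gamma : R) :
  0 < alpha -> 0 < gamma -> 0 <= r ->
  s = gamma * r * alpha -> d = v + alpha *: g -> r * `|d| ^+ 2 = ip b d ->
  ip (x - s *: g - x') (u - x') <= 0 -> ip v (b - (x - x')) <= 0 ->
  0 <= ip g (x - b - u) ->
  `|x' - u| ^+ 2 <= `|x - u| ^+ 2 - gamma * (2 - gamma) * (r ^+ 2 * `|d| ^+ 2).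
Proof.
move=> alpha0 gamma0 r0 sE dE rd.
have -> : x - s *: g - x' = (x - x') - s *: g by rewrite addrAC.
have -> : u - x' = (x - x') - (x - u) by rewrite opprB [RHS]addrC subrKA.
have -> : x - b - u = (x - u) - b by rewrite addrAC.
have -> : x' - u = (x - u) - (x - x') by rewrite opprB [RHS]addrC subrKA.
move: (x - x') (x - u) => a c hproj hv hg.
rewrite [X in X <= _](normB2 ipH) (ipC ip c).
have s0 : 0 <= s by rewrite sE !mulr_ge0// ltW.
have gr0 : 0 <= gamma * r by rewrite mulr_ge0// ltW.
(* Since [alpha *: g = d - v], the term in [g] becomes one in [d] plus one in [v] of known sign. *)
have sgv : s * ip g (a - b) = gamma * r * (ip d (a - b) - ip v (a - b)).
  by rewrite dE sE ipDl ipZl; ring.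
have hv' : 0 <= gamma * r * ip v (a - b).
  by apply: mulr_ge0 => //; rewrite -opprB ipNr oppr_ge0.
have hg' : 0 <= s * ip g (c - b) by exact: mulr_ge0.
(* Completing this square absorbs the cross term [ip a d]; with [rd'] only a multiple of
   [gamma ^+ 2 - 2 * gamma] is left. *)
have sq := sqr_ge0 `|a - (gamma * r) *: d|.
rewrite (normB2 ipH) normrZ exprMn real_normK ?num_real// ipZr in sq.
have rd' : gamma * r * ip d b = gamma * (r * (r * `|d| ^+ 2)).
  by rewrite rd (ipC ip b); ring.
move: hproj sgv hv' hg' sq rd'; rewrite !ipE -!(normE ipH) (ipC ip a d).
have -> : (gamma * r) ^+ 2 * `|d| ^+ 2 = gamma ^+ 2 * (r * (r * `|d| ^+ 2)).
  by ring.
have -> : r ^+ 2 * `|d| ^+ 2 = r * (r * `|d| ^+ 2) by ring.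
by lra.
Qed.

(** The line search test bounds [ip b d] below by [1 - mu] times the square of the norm of [b], and
    the norm of [d] above by [1 + mu] times that of [b]; their quotient gives the constant. *)
Lemma msegm_step alpha mu gamma x x' u :
  let y := trial_point C F alpha x in
  0 < alpha -> 0 < mu < 1 -> 0 < gamma < 2 ->
  SOL ip C F u -> linesearch_test C F mu alpha x -> x != y ->
  x' = metric_proj (halfspace ip F alpha x y)
    (x - (gamma * dir_step ip F alpha x y * alpha) *: F y) ->
  `|x' - u| ^+ 2 <= `|x - u| ^+ 2
     - gamma * (2 - gamma) * ((1 - mu) / (1 + mu)) ^+ 2 * `|x - y| ^+ 2.
Proof.
move=> y alpha0 /andP[mu0 mu1] /andP[g0 g2] Su test xy x'E.
set d := direction F alpha x y; set r := dir_step ip F alpha x y.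
set b := x - y.
have b0 : 0 < `|b| by rewrite normr_gt0 subr_eq0.
have eb : `|alpha *: (F x - F y)| <= mu * `|b| by rewrite normrZ gtr0_norm.
have bd : (1 - mu) * `|b| ^+ 2 <= ip b d.
  rewrite /d /direction -/b ipDr ipNr -(normE ipH).
  have := le_trans (ler_norm _) (ip_le_norm ipH b (alpha *: (F x - F y))).
  by move: eb; set e := `|_ *: _|; nra.
have dle : `|d| <= (1 + mu) * `|b|.
  by rewrite /d /direction -/b; apply: le_trans (ler_normB _ _) _; lra.
have bd0 : 0 < ip b d.
  by apply: lt_le_trans bd; rewrite mulr_gt0 ?exprn_gt0 ?subr_gt0.
have d0 : 0 < `|d|.
  by rewrite normr_gt0; apply: contraTneq bd0 => ->; rewrite linear0r ltxx.
have rd : r * `|d| ^+ 2 = ip b d by rewrite mulfVK// expf_neq0// gt_eqF.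
have r0 : 0 <= r by rewrite divr_ge0// ltW// exprn_gt0.
(* Besides serving as test point, [u] makes the halfspace nonempty, so [metric_proj] is a true
   nearest point and not the default 0. *)
have Tu : halfspace ip F alpha x y u by apply: trial_point_ip_le0; case: Su.
have proj := metric_projP ipH
  (x - (gamma * r * alpha) *: F y) (ex_intro _ u Tu)
  (@halfspace_closed alpha x y) (@halfspace_convex alpha x y).
rewrite -x'E in proj.
have step := @projection_step x x' u b (F y) (x - alpha *: F x - y) d r
  (gamma * r * alpha) alpha gamma alpha0 g0 r0 erefl.
apply: le_trans (step _ rd _ _ _) _.
- rewrite /d /direction scalerBr opprB.
  rewrite [in RHS](addrAC x) -[RHS]addrA; congr (_ + _).
  by rewrite [RHS]addrC.
- exact: (nearest_point_ip_le0 ipH (@halfspace_convex alpha x y) proj Tu).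
- have -> : b - (x - x') = x' - y by rewrite /b opprB addrC subrKA.
  by case: proj.
- rewrite /b opprB addrCA subrr addr0.
  by apply: SOL_dual => //; exact: trial_point_in.
(* It remains to bound [r] times the norm of [d] below; multiplying by that norm turns the product
   into [ip b d]. *)
rewrite lerD2l lerN2 -mulrA ler_wpM2l//; first by nra.
have m0 : 0 <= (1 - mu) / (1 + mu) by rewrite divr_ge0//; lra.
rewrite -exprMn -exprMn ler_pXn2r ?nnegrE ?(mulr_ge0 m0) ?(mulr_ge0 r0)//.
rewrite mulrAC ler_pdivrMr; last by lra.
rewrite -(ler_pM2r d0).
have -> : r * `|d| * (1 + mu) * `|d| = ip b d * (1 + mu) by rewrite -rd; ring.
apply: (@le_trans _ _ ((1 - mu) * `|b| ^+ 2 * (1 + mu))).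
  have -> : (1 - mu) * `|b| ^+ 2 * (1 + mu)
      = (1 - mu) * `|b| * ((1 + mu) * `|b|).
    by ring.
  by rewrite ler_wpM2l// mulr_ge0 ?subr_ge0// ltW.
by rewrite ler_wpM2r//; lra.
Qed.

(** Monotonicity replaces [F (x n)] by [F z] with [z] fixed, so only pairings of [x n] with fixed
    vectors have to pass to the weak limit; [minty] does the rest. *)
Lemma weak_limit_SOL (U : set_system nat) (x y : nat -> H) (p : H)
    (alpha : nat -> R) L amin M :
  0 < L -> (forall u v, `|F u - F v| <= L * `|u - v|) ->
  0 < amin -> (forall n, amin <= alpha n) ->
  (forall n, y n = trial_point C F (alpha n) (x n)) ->
  (forall n, `|x n| <= M) ->
  ProperFilter U -> `|x n - y n| @[n --> U] --> (0 : R) ->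
  (forall h, ip (x n) h @[n --> U] --> ip p h) -> SOL ip C F p.
Proof.
move=> L0 lipF amin0 aminP yE xM UU exy xp.
have cvx h : ip h (x n) @[n --> U] --> ip h p.
  by under eq_fun do rewrite ipC; rewrite ipC; exact: xp.
(* [C] is weakly closed: the projection [q] of [p] separates [p] from all [y n], and [x n - y n]
   vanishes, so in the limit [p - q] has norm 0. *)
have Cp : C p.
  have [Cq hq] := metric_projP ipH p C0 clC cC.
  set q := metric_proj C p in Cq hq.
  have hle n : ip (p - q) (x n) <= `|p - q| * `|x n - y n| + ip (p - q) q.
    have Cyn : C (y n) by rewrite yE; exact: trial_point_in.
    have := nearest_point_ip_le0 ipH cC (conj Cq hq) Cyn.
    have := le_trans (ler_norm _) (ip_le_norm ipH (p - q) (x n - y n)).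
    by rewrite !(ipDr _ _ _ (p - q)) !ipNr; lra.
  have lim0 : ip (p - q) p <= `|p - q| * 0 + ip (p - q) q.
    have cvr : `|p - q| * `|x n - y n| + ip (p - q) q @[n --> U]
        --> `|p - q| * 0 + ip (p - q) q.
      by apply: cvgD; [apply: cvgM => //|]; exact: cvg_cst.
    by apply: ler_cvg_to (cvx (p - q)) cvr _; exact: nearW.
  suff /eqP : p - q = 0 by rewrite subr_eq0 => /eqP ->.
  apply/eqP; rewrite -normr_eq0 -sqrf_eq0 eq_le sqr_ge0 andbT (normE ipH).
  by rewrite ipDr ipNr; lra.
apply: (minty L0 lipF Cp) => z Cz.
pose K := `|z| + M.
pose e n := `|x n - y n|.
have zxK n : `|z - x n| <= K.
  by apply: le_trans (ler_normB _ _) _; rewrite lerD2l.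
have K0 : 0 <= K := le_trans (normr_ge0 _) (zxK 0%N).
pose B := `|F z| + L * K.
have FB n : `|F (x n)| <= B.
  rewrite -[F (x n)](subrK (F z)) addrC; apply: le_trans (ler_normD _ _) _.
  rewrite lerD2l; apply: le_trans (lipF _ _) _.
  by rewrite (ler_wpM2l (ltW L0))// distrC.
have key n : ip (F z) (x n) <= ip (F z) z + (e n * (K + e n) / amin + B * e n).
  have e0 : 0 <= e n by exact: normr_ge0.
  have zyK : `|z - y n| <= K + e n.
    rewrite -(subrKA (x n)); apply: le_trans (ler_normD _ _) _.
    by rewrite lerD2r.
  have xyz := ip_le_norm ipH (x n - y n) (z - y n).
  have : - (e n * (K + e n)) <= alpha n * ip (F (x n)) (z - y n).
    have := trial_point_ip_le0 (alpha n) (x n) Cz; rewrite -yE.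
    rewrite addrAC ipDl ipNl ipZl => tp.
    have : `|ip (x n - y n) (z - y n)| <= e n * (K + e n).
      by apply: le_trans xyz _; rewrite ler_wpM2l.
    by rewrite ler_norml => /andP[+ _]; lra.
  have amn := aminP n.
  have an0 : 0 < alpha n by exact: lt_le_trans amn.
  have s0 : 0 <= e n * (K + e n) by rewrite (mulr_ge0 e0)// addr_ge0.
  move=> le1.
  have {le1} le1 : - (e n * (K + e n) / amin) <= ip (F (x n)) (z - y n).
    rewrite lerNl ler_pdivlMr//.
    (* Only a lower bound on [alpha n] is known: a nonnegative pairing is trivial, and for a
       negative one [amin] may replace [alpha n]. *)
    have [t0|t0] := leP 0 (ip (F (x n)) (z - y n)).
      by apply: le_trans s0; rewrite mulNr oppr_le0 mulr_ge0// ltW.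
    apply: le_trans (_ : - (alpha n * ip (F (x n)) (z - y n)) <= _); last lra.
    by rewrite -mulrN mulrC ler_wpM2r// oppr_ge0 ltW.
  have := le_trans (ler_norm _) (ip_le_norm ipH (F (x n)) (x n - y n)).
  rewrite -/(e n) => le2.
  have {le2} le2 : ip (F (x n)) (x n - y n) <= B * e n.
    by apply: le_trans le2 _; rewrite ler_wpM2r.
  have le3 := monoF z (x n).
  move: le1 le2 le3; rewrite ipDl !ipDr !ipNr !ipNl.
  by move: (_ / amin) (B * e n) => E G; lra.
have : ip (F z) p <= ip (F z) z + (0 * (K + 0) / amin + B * 0).
  have cvr : ip (F z) z + (e n * (K + e n) / amin + B * e n) @[n --> U]
      --> ip (F z) z + (0 * (K + 0) / amin + B * 0).
    apply: cvgD; first exact: cvg_cst.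
    apply: cvgD; last by apply: cvgM => //; exact: cvg_cst.
    apply: cvgM; last exact: cvg_cst.
    by apply: cvgM => //; apply: cvgD => //; exact: cvg_cst.
  by apply: ler_cvg_to (cvx (F z)) cvr _; exact: nearW.
by rewrite ipDr ipNr; lra.
Qed.

(** By the Lipschitz bound every step size up to [mu / L] passes the test, so the last rejected one
    is at least [mu / L], and the accepted one is [rho] times it. *)
Lemma linesearch_lower_bound L sigma rho mu x (m : nat) :
  0 < L -> (forall u v, `|F u - F v| <= L * `|u - v|) ->
  0 < sigma -> 0 < rho ->
  (forall j, (j < m)%N -> ~ linesearch_test C F mu (sigma * rho ^+ j) x) ->
  Num.min sigma (mu * rho / L) <= sigma * rho ^+ m.
Proof.
move=> L0 lipF sigma0 rho0; case: m => [_|m /(_ m (leqnn _)) fail].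
  by rewrite expr0 mulr1 ge_min lexx.
rewrite ge_min; apply/orP; right.
rewrite ler_pdivrMr// exprS mulrCA [leRHS]mulrAC mulrC -[leRHS]mulrA ler_pM2l//.
rewrite leNgt; apply/negP => small; apply: fail.
rewrite /linesearch_test; set y := trial_point _ _ _ _.
have a0 : 0 < sigma * rho ^+ m by rewrite mulr_gt0// exprn_gt0.
apply: (@le_trans _ _ (sigma * rho ^+ m * (L * `|x - y|))).
  by rewrite ler_pM2l.
by rewrite mulrA [_ * L]mulrC ler_wpM2r// ltW.
Qed.

End VariationalInequality.

(** * Convergence of the method *)

Lemma cvg0_sqr (R : realType) (a : nat -> R) :
  a n ^+ 2 @[n --> \oo] --> 0 -> a n @[n --> \oo] --> 0.
Proof.
move=> /cvgr0Pnorm_lt a2; apply/cvgr0Pnorm_lt => e e0.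
have := a2 (e ^+ 2) (exprn_gt0 _ e0); apply: filterS => n.
by rewrite normrX ltr_pXn2r ?nnegrE// ltW.
Qed.

Theorem theorem3p1 (R : realType) (H : completeNormedModType R)
    (ip : {dot H for idfun}) (C : set H) (F : H -> H)
    (L sigma rho mu gamma : R) (x0 : H)
    (x y : nat -> H) (m : nat -> nat) :
  induces_norm ip ->
  C !=set0 -> closed C -> convex_set C ->
  SOL ip C F !=set0 ->
  monotone_map ip F ->
  0 < L -> (forall u v, `|F u - F v| <= L * `|u - v|) ->
  0 < sigma -> 0 < rho < 1 -> 0 < mu < 1 -> 0 < gamma < 2 ->
  msegm_run ip C F sigma rho mu gamma x0 x y m ->
  (forall k, x k != y k) ->
  exists2 p, SOL ip C F p & weak_cvg x p.
Proof.
move=> ipH C0 clC cC S0 monoF L0 lipF sigma0 /andP[rho0 rho1] mu01 gamma02.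
move=> run xy.
have /andP[mu0 mu1] := mu01; have /andP[gamma0 gamma2] := gamma02.
set c := gamma * (2 - gamma) * ((1 - mu) / (1 + mu)) ^+ 2.
have c0 : 0 < c.
  apply: mulr_gt0; first by apply: mulr_gt0; lra.
  by apply/exprn_gt0/divr_gt0; lra.
have step k u : SOL ip C F u ->
    `|x k.+1 - u| ^+ 2 <= `|x k - u| ^+ 2 - c * `|x k - y k| ^+ 2.
  move=> Su; have alpha0 : 0 < sigma * rho ^+ m k.
    by rewrite mulr_gt0// exprn_gt0.
  have := msegm_step ipH C0 clC cC monoF (x := x k) (x' := x k.+1) alpha0 mu01
    gamma02 Su (run_linesearch run k).
  by rewrite -(run_y run k); apply => //; exact: run_x run k.
have fejer u : SOL ip C F u -> nonincreasing_seq (fun n => `|x n - u| ^+ 2).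
  move=> Su; apply/nonincreasing_seqP => n; apply: le_trans (step n u Su) _.
  by rewrite lerBlDr lerDl mulr_ge0 ?sqr_ge0 ?ltW.
have [u Su] := S0.
have exy : `|x n - y n| @[n --> \oo] --> (0 : R).
  apply: cvg0_sqr.
  have /cvg_ex[l cvl] : cvgn (fun n => `|x n - u| ^+ 2).
    apply: nonincreasing_is_cvgn; first exact: fejer.
    by exists 0 => _ [n _ <-]; exact: sqr_ge0.
  (* Consecutive differences of a convergent sequence vanish, and by [step] they dominate the
     squared residuals. *)
  pose a n := (`|x n - u| ^+ 2 - `|x n.+1 - u| ^+ 2) / c.
  have cva : a n @[n --> \oo] --> 0.
    rewrite -(mul0r c^-1) -(subrr l); apply: cvgM; last exact: cvg_cst.
    by apply: cvgB => //; rewrite (cvg_shiftS (fun n => `|x n - u| ^+ 2)).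
  apply: squeeze_cvgr (cvg_cst 0) cva; near=> n.
  rewrite sqr_ge0 /= /a ler_pdivlMr// mulrC.
  by have := step n u Su; lra.
have bnd := nonincreasing_dist_bounded (fejer u Su).
apply: (fejer_monotone_weak_cvg ipH S0 fejer) => U p UU oU xp.
have alphaP n : Num.min sigma (mu * rho / L) <= sigma * rho ^+ m n.
  apply: linesearch_lower_bound L0 lipF sigma0 rho0 _.
  exact: run_linesearch_min run n.
have amin0 : 0 < Num.min sigma (mu * rho / L).
  by rewrite lt_min sigma0 divr_gt0 ?mulr_gt0.
apply: (@weak_limit_SOL _ _ ip ipH C F C0 clC cC monoF U x y p
  (fun n => sigma * rho ^+ m n) L _ _ L0 lipF amin0 alphaP (run_y run) bnd
  _ _ xp).
by apply: cvg_trans exy => A; exact: oU.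
Unshelve. all: by end_near. Qed.
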